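(* Let $\varepsilon\in(0,\tfrac12)$ be the fixed constant of the quantum planted-clique conjecture qPC, and suppose qPC holds. Let $k=k(n)$ satisfy $(2+\varepsilon)\log_2 n\le k\le n^{1/2-\varepsilon}$ and set $d=k-2$. Then no efficient algorithm decides whether $H_d(\mathrm{skel}_dX(G))=0$ with success probability $\ge\tfrac12+\delta$ over $G\sim\mathcal{D}_k$, for a constant $\delta>0$.
   Context: Graphs are simple graphs on $[n]=\{1,\dots,n\}$. $G(n,\tfrac12)$ is the Erdős–Rényi distribution (each edge present independently with probability $\tfrac12$). $G(n,\tfrac12,k)$ is obtained by drawing $G_0\sim G(n,\tfrac12)$, choosing a uniformly random $k$-subset $S\subseteq[n]$ and adding every edge inside $S$. $\mathcal{D}_k=\tfrac12G(n,\tfrac12)+\tfrac12G(n,\tfrac12,k)$. The clique complex $X(G)$ is the simplicial complex whose $d$-simplices are the $(d+1)$-cliques of $G$; $\mathrm{skel}_dX(G)$ keeps exactly the faces of dimension $\le d$. Homology is with coefficients in $\mathbb{R}$. An efficient algorithm is a randomized or quantum algorithm with classical output running in time $\mathrm{poly}(n)$; it receives $G$ and $d$. Quantum planted-clique conjecture (qPC): for every $k=k(n)$ with $(2+\varepsilon)\log_2 n\le k\le n^{1/2-\varepsilon}$ and every constant $\delta>0$, no polynomial-time quantum algorithm (knowing $n$ and $k$) distinguishes $G(n,\tfrac12)$ from $G(n,\tfrac12,k)$ with advantage $\ge\delta$, where the advantage is the absolute difference of the probabilities of outputting ''planted'' under the two distributions. ''No algorithm achieves probability (or advantage) at least $q$''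 means that no algorithm achieves this for all sufficiently large $n$. *)

(* Defs.v *)
(* MathComp-Analysis; R is an arbitrary model of the real numbers. *)
From HB Require Import structures.
From mathcomp Require Import all_boot all_order all_algebra.
From mathcomp Require Import boolp classical_sets reals topology normedtype
  sequences exp.
From mathcomp.real_closed Require Import complex.

Set Implicit Arguments.
Unset Strict Implicit.
Unset Printing Implicit Defensive.

Import Order.TTheory GRing.Theory Num.Theory.
Import numFieldNormedType.Exports.

Local Open Scope classical_set_scope.
Local Open Scope ring_scope.

Definition edge (n : nat) := {e : {set 'I_n} | #|e| == 2%N}.

(* A simple graph on n vertices is its set of edges. *)
Definition graph (n : nat) := {set edge n}.

Definition adj (n : nat) (G : graph n) (u v : 'I_n) : bool :=
  [exists e in G, val e == [set u; v]%SET].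

Definition plant (n : nat) (G : graph n) (S : {set 'I_n}) : graph n :=
  (G :|: [set e : edge n | val e \subset S])%SET.

Section Distributions.
Variable R : realType.

(* Distributions on graphs are given by their probability mass functions. *)

Definition gnp_half (n : nat) (G : graph n) : R :=
  \prod_(e : edge n) (if e \in G then 2^-1 else 1 - 2^-1).

Definition gnp_planted (n k : nat) (G : graph n) : R :=
  \sum_(G0 : graph n) \sum_(S : {set 'I_n} | #|S| == k)
     gnp_half G0 * ('C(n, k))%:R^-1 * (G == plant G0 S)%:R.

Definition planted_mixture (n k : nat) (G : graph n) : R :=
  2^-1 * gnp_half G + 2^-1 * gnp_planted k G.

Definition mean (n : nat) (D f : graph n -> R) : R :=
  \sum_(G : graph n) D G * f G.

End Distributions.

(* Complexes on the vertex set 'I_n are given by their sets of nonempty faces;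
   a face of cardinality d.+1 has dimension d. *)

Definition clique_complex (n : nat) (G : graph n) : {set {set 'I_n}} :=
  [set s : {set 'I_n} | (0 < #|s|)%N &&
     [forall u in s, forall v in s, (u != v) ==> adj G u v]]%SET.

Definition skel (n d : nat) (K : {set {set 'I_n}}) : {set {set 'I_n}} :=
  [set s in K | (#|s| <= d.+1)%N]%SET.

Definition face (n : nat) (K : {set {set 'I_n}}) (d : nat) :=
  {s : {set 'I_n} | (s \in K) && (#|s| == d.+1)}.

Section Homology.
Variables (R : realType) (n : nat) (K : {set {set 'I_n}}).

Definition chain (d : nat) := {ffun face K d -> R^o}.

(* Faces are oriented by the order on the vertices: the coefficient of s :\ v
   in the boundary of s is (-1)^j, where j is the rank of v in s. *)
Definition bd_fun (d : nat) (c : chain d.+1) : chain d :=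
  [ffun t : face K d => \sum_(s : face K d.+1)
     \sum_(v in val s | (val s :\ v)%SET == val t)
        (-1) ^+ #|[set u in val s | (u < v)%N]%SET| * (c s : R)].

Fact bd_fun_linear (d : nat) : linear (@bd_fun d).
Proof.
move=> a x y; apply/ffunP => t; rewrite !ffunE scaler_sumr -big_split /=.
apply: eq_bigr => s _; rewrite scaler_sumr -big_split /=.
apply: eq_bigr => v _; rewrite !ffunE mulrDr; congr (_ + _).
by rewrite /GRing.scale /= mulrCA.
Qed.

HB.instance Definition _ (d : nat) :=
  GRing.isLinear.Build R (chain d.+1) (chain d) *:%R (@bd_fun d)
    (@bd_fun_linear d).

Definition bd (d : nat) : 'Hom(chain d.+1, chain d) := linfun (@bd_fun d).

(* Homology is not reduced: every 0-chain is a cycle. *)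
Definition cycles (d : nat) : {vspace chain d} :=
  if d is e.+1 then lker (bd e) else fullv.

Definition boundaries (d : nat) : {vspace chain d} := limg (bd d).

(* The boundaries, as a predicate on the space of cycles. *)
Definition is_boundary (d : nat) : pred (subvs_of (cycles d)) :=
  fun z => vsval z \in boundaries d.

Fact is_boundary_zmod_closed (d : nat) : zmod_closed (@is_boundary d).
Proof.
have E z : (z \in @is_boundary d) = (vsval z \in boundaries d) by [].
by split=> [|x y]; rewrite !E ?linear0 ?mem0v // linearB /=; apply: rpredB.
Qed.

HB.instance Definition _ (d : nat) :=
  GRing.isZmodClosed.Build (subvs_of (cycles d)) (@is_boundary d)
    (@is_boundary_zmod_closed d).

(* The quotient group H_d = Z_d / B_d. *)
Definition homology (d : nat) : zmodType :=
  Quotient.quot (GRing.ZmodClosed.clone _ (@is_boundary d) _).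

Definition homology_vanishes (d : nat) : Prop :=
  forall h : homology d, h = 0.

End Homology.

(* A classical random access machine that can toss coins and controls a
   quantum memory.  The classical store consists of registers and of an
   indirectly addressed memory, both holding natural numbers.  All operands
   [r], [a], ... of the instructions name registers; the quantum instructions
   act on the qubits whose indices are held in the registers [a], [b].  Gates
   applied to qubits that are not allocated do nothing.  A randomized algorithm
   is a program without quantum instructions; a quantum algorithm is an
   arbitrary program.  Hadamard, T and CNOT gates are universal, and additions
   and subtractions at unit cost keep polynomial time the usual one. *)
Inductive instr : Type :=
| Const (r m : nat)
| Add (r s : nat)
| Sub (r s : nat)
| Read (r a : nat)      (* r := memory cell whose address is held in a *)
| Write (a r : nat)     (* memory cell whose address is held in a := r *)
| Jz (r l : nat)        (* go to line l if r holds 0 *)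
| Coin (r : nat)
| Newq                  (* allocate a qubit in state |0> *)
| Had (a : nat)
| Tgate (a : nat)
| Cnot (a b : nat)      (* control a, target b *)
| Meas (a r : nat).     (* measure a in the computational basis into r *)

Definition program := seq instr.

Section Machine.
Variable R : realType.

(* The amplitudes of the basis states of the [qnum] allocated qubits are the
   values of [amp] on bit sequences of size [qnum]; the other values of [amp]
   are irrelevant.  The state is not renormalized after measurements, so its
   squared norm is the probability of the measurement outcomes so far. *)
Record config := Config {
  pc : nat;
  regs : nat -> nat;
  memory : nat -> nat;
  qnum : nat;
  amp : seq bool -> R[i] }.

Definition upd (f : nat -> nat) (x v : nat) : nat -> nat :=
  fun y => if y == x then v else f y.

Definition bit (b : seq bool) (q : nat) : bool := nth false b q.

Definition setbit (b : seq bool) (q : nat) (v : bool) : seq bool :=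
  set_nth false b q v.

Definition sqrt_half : R[i] := (Num.sqrt (2^-1 : R))%:C%C.

(* exp(i pi / 4) *)
Definition omega8 : R[i] :=
  Complex (Num.sqrt (2^-1 : R)) (Num.sqrt (2^-1 : R)).

Definition had_amp (q : nat) (psi : seq bool -> R[i]) : seq bool -> R[i] :=
  fun b => sqrt_half * (psi (setbit b q false)
                        + (-1) ^+ bit b q * psi (setbit b q true)).

Definition t_amp (q : nat) (psi : seq bool -> R[i]) : seq bool -> R[i] :=
  fun b => omega8 ^+ bit b q * psi b.

Definition cnot_amp (p q : nat) (psi : seq bool -> R[i]) : seq bool -> R[i] :=
  fun b => psi (setbit b q (bit b q (+) bit b p)).

Definition new_amp (q : nat) (psi : seq bool -> R[i]) : seq bool -> R[i] :=
  fun b => if bit b q then 0 else psi (take q b).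

Definition proj_amp (q : nat) (v : bool) (psi : seq bool -> R[i]) :
    seq bool -> R[i] :=
  fun b => if bit b q == v then psi b else 0.

Definition weight (c : config) : R :=
  \sum_(b : (qnum c).-tuple bool)
     (complex.Re (amp c b) ^+ 2 + complex.Im (amp c b) ^+ 2).

(* The possible successors of a configuration.  The real factors are the
   probabilities of coin tosses; those of measurement outcomes are carried by
   the amplitudes. *)
Definition step (i : instr) (c : config) : seq (R * config) :=
  let: Config p f m q psi := c in
  match i with
  | Const r x => [:: (1, Config p.+1 (upd f r x) m q psi)]
  | Add r s => [:: (1, Config p.+1 (upd f r (f r + f s)%N) m q psi)]
  | Sub r s => [:: (1, Config p.+1 (upd f r (f r - f s)%N) m q psi)]
  | Read r a => [:: (1, Config p.+1 (upd f r (m (f a))) m q psi)]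
  | Write a r => [:: (1, Config p.+1 f (upd m (f a) (f r)) q psi)]
  | Jz r l => [:: (1, Config (if f r == 0%N then l else p.+1) f m q psi)]
  | Coin r => [:: (2^-1, Config p.+1 (upd f r 0) m q psi);
                  (2^-1, Config p.+1 (upd f r 1) m q psi)]
  | Newq => [:: (1, Config p.+1 f m q.+1 (new_amp q psi))]
  | Had a => [:: (1, Config p.+1 f m q
                       (if (f a < q)%N then had_amp (f a) psi else psi))]
  | Tgate a => [:: (1, Config p.+1 f m q
                         (if (f a < q)%N then t_amp (f a) psi else psi))]
  | Cnot a b => [:: (1, Config p.+1 f m q
                          (if [&& (f a < q)%N, (f b < q)%N & f a != f b]
                           then cnot_amp (f a) (f b) psi else psi))]
  | Meas a r =>
      if (f a < q)%N then
        [:: (1, Config p.+1 (upd f r 0) m q (proj_amp (f a) false psi));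
            (1, Config p.+1 (upd f r 1) m q (proj_amp (f a) true psi))]
      else [:: (1, Config p.+1 (upd f r 0) m q psi)]
  end.

(* The probability that A, started in c, halts within t steps with an output
   (the content of register 0) satisfying P.  A halts when the program counter
   leaves the program. *)
Fixpoint halt_prob (A : program) (P : pred nat) (t : nat) (c : config) : R :=
  match onth A (pc c), t with
  | None, _ => if P (regs c 0) then weight c else 0
  | Some _, 0 => 0
  | Some i, t'.+1 => \sum_(wc <- step i c) wc.1 * halt_prob A P t' wc.2
  end.

(* Input: register 0 holds the number n of vertices, register 1 an integer
   parameter, and memory cell u * n + v tells whether u and v are adjacent. *)
Definition init (n : nat) (G : graph n) (x : nat) : config :=
  Config 0
    (fun r => match r with 0 => n | 1 => x | _ => 0 end)%N
    (fun a => [exists u : 'I_n, exists v : 'I_n,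
                 (a == u * n + v)%N && adj G u v] : nat)
    0 (fun=> 1).

(* On graphs with n vertices and parameters at most n, the program halts almost
   surely within a number of steps that is polynomial in n. *)
Definition poly_time (A : program) : Prop :=
  exists c : nat, forall (n : nat) (G : graph n) (x : nat), (x <= n)%N ->
    halt_prob A predT (n ^ c + c) (init G x) = 1.

Definition output_prob (A : program) (P : pred nat) (n : nat) (G : graph n)
    (x : nat) : R :=
  limn (fun t => halt_prob A P t (init G x)).

(* A nonzero output means "yes". *)
Definition accept_prob (A : program) (n : nat) (G : graph n) (x : nat) : R :=
  output_prob A (fun o => o != 0%N) G x.

Definition reject_prob (A : program) (n : nat) (G : graph n) (x : nat) : R :=
  output_prob A (fun o => o == 0%N) G x.

(* "yes" means "planted"; the parameter given to the algorithm is k. *)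
Definition advantage (A : program) (n k : nat) : R :=
  `| mean (@gnp_half R n) (fun G => accept_prob A G k)
     - mean (@gnp_planted R n k) (fun G => accept_prob A G k) |.

(* The bounds can only be required of large n: they are contradictory for
   small n, such as n = 2. *)
Definition clique_range (eps : R) (k : nat -> nat) : Prop :=
  \forall n \near \oo,
    (2 + eps) * (ln n%:R / ln 2) <= (k n)%:R <= n%:R `^ (2^-1 - eps).

Definition qPC (eps : R) : Prop :=
  forall k : nat -> nat, clique_range eps k ->
  forall delta : R, 0 < delta ->
  ~ exists A : program,
      poly_time A /\ \forall n \near \oo, delta <= advantage A n (k n).

(* The probability, over G drawn from D and the randomness of A, that A
   given G and d answers correctly whether the d-th homology group of the
   d-skeleton of the clique complex of G is 0. *)
Definition homology_success (A : program) (n : nat) (D : graph n -> R)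
    (d : nat) : R :=
  mean D (fun G =>
    if `[< homology_vanishes R (skel d (clique_complex G)) d >]
    then accept_prob A G d else reject_prob A G d).

End Machine.

(* Main.v *)
(* Put d = k - 2.  There are no (d+1)-dimensional faces in the d-skeleton, so
   H_d is the space of d-cycles.  A planted k-clique is a full (d+1)-simplex of
   the clique complex, whose boundary is a nonzero d-cycle: on planted graphs
   H_d never vanishes.  A graph without (k-1)-cliques has no d-chains at all,
   hence H_d = 0; by the first moment method this holds with probability
   1 - o(1) for G(n, 1/2), because
     (C(n, k-1) 2^-C(k-1, 2))^2 <= (n^2 / 2^(k-2))^(k-1)  and  2^k >= n^(2+eps).
   A decider with success probability 1/2 + delta therefore distinguishes the
   two distributions with advantage at least 2 delta - o(1), after a
   preprocessing that replaces the parameter k by k - 2. *)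

Require Import Defs.
From mathcomp Require Import all_boot all_order all_algebra.
From mathcomp Require Import boolp classical_sets reals topology normedtype
  sequences exp.
From mathcomp.real_closed Require Import complex.
From mathcomp Require Import ring lra.

Set Implicit Arguments.
Unset Strict Implicit.
Unset Printing Implicit Defensive.

Import Order.TTheory GRing.Theory Num.Theory.
Import numFieldNormedType.Exports.
Local Open Scope classical_set_scope.
Local Open Scope ring_scope.

(** * Machines *)

Section Machine.
Context {R : realType}.
Implicit Types (A : program) (P : pred nat) (c : config R).

(** * Bit strings and conservation of the squared norm *)

Lemma size_setbit (b : seq bool) q v :
  (q < size b)%N -> size (setbit b q v) = size b.
Proof. by move=> qb; rewrite size_set_nth; apply/maxn_idPr. Qed.

Lemma bit_setbit (b : seq bool) q v p :
  bit (setbit b q v) p = if p == q then v else bit b p.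
Proof. by rewrite /bit /setbit nth_set_nth. Qed.

Lemma eq_bits (b b' : seq bool) :
  size b = size b' -> bit b =1 bit b' -> b = b'.
Proof. by move=> eqs eqb; apply: (@eq_from_nth _ false) => // i _; apply: eqb. Qed.

Definition flip q (b : seq bool) := setbit b q (~~ bit b q).

Lemma flipK q (b : seq bool) : (q < size b)%N -> flip q (flip q b) = b.
Proof.
move=> qb; apply: eq_bits => [|p]; first by rewrite /flip !size_setbit.
by rewrite /flip !bit_setbit eqxx; case: eqP => // ->; rewrite negbK.
Qed.

Lemma setbit_bit q (b : seq bool) : (q < size b)%N -> setbit b q (bit b q) = b.
Proof.
move=> qb; apply: eq_bits => [|p]; first by rewrite !size_setbit.
by rewrite bit_setbit; case: eqP => // ->.
Qed.

Lemma setbit_flip q v (b : seq bool) :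
  (q < size b)%N -> setbit (flip q b) q v = setbit b q v.
Proof.
move=> qb; apply: eq_bits => [|p]; first by rewrite /flip !size_setbit.
by rewrite /flip !bit_setbit; case: eqP.
Qed.

(** Hadamard on [q], or CNOT with target [q], mixes amplitudes only within the pairs [b],
    [flip q b], so it suffices to compare norms pair by pair. *)
Lemma eq_sum_flip n q (F G : seq bool -> R) : (q < n)%N ->
    (forall b, size b = n -> F b + F (flip q b) = G b + G (flip q b)) ->
  \sum_(b : n.-tuple bool) F b = \sum_(b : n.-tuple bool) G b.
Proof.
move=> qn FG.
pose h (b : n.-tuple bool) : n.-tuple bool := insubd b (flip q b).
have hE b : h b = flip q b :> seq bool.
  by rewrite val_insubd size_setbit size_tuple ?eqxx.
have hK : involutive h.
  by move=> b; apply/val_inj; rewrite /= !hE flipK ?size_tuple.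
(* Summing over pairs counts each string twice; cancelling the factor 2 avoids choosing a
   representative of each pair. *)
have dbl (H : seq bool -> R) : \sum_(b : n.-tuple bool) (H b + H (flip q b)) =
    (\sum_(b : n.-tuple bool) H b) *+ 2 :> R.
  rewrite big_split mulr2n /=; congr (_ + _).
  rewrite [RHS](reindex_inj (can_inj hK)) /=.
  by apply: eq_bigr => b _; rewrite hE.
apply/eqP; rewrite -(eqr_pMn2r (n := 2)) // -!dbl; apply/eqP.
by apply: eq_bigr => b _; rewrite FG ?size_tuple.
Qed.

Definition norm2 (z : R[i]) : R := complex.Re z ^+ 2 + complex.Im z ^+ 2.

Lemma norm2_ge0 z : 0 <= norm2 z.
Proof. by rewrite addr_ge0 ?sqr_ge0. Qed.

Lemma norm2_0 : norm2 0 = 0.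
Proof. by rewrite /norm2 /= expr0n addr0. Qed.

Lemma sqr_sqrt_half : Num.sqrt (2^-1 : R) ^+ 2 = 2^-1.
Proof. by rewrite sqr_sqrtr ?invr_ge0. Qed.

Lemma norm2_omega8 z : norm2 (omega8 R * z) = norm2 z.
Proof.
case: z => x y; rewrite /norm2 /omega8 /=; have := sqr_sqrt_half.
move: (Num.sqrt _) => s ss.
transitivity (s ^+ 2 * 2 * (x ^+ 2 + y ^+ 2)); first by ring.
by rewrite ss mulVf ?mul1r ?pnatr_eq0.
Qed.

(** The parallelogram identity, scaled by [1/2]. *)
Lemma norm2_had x y :
  norm2 (sqrt_half R * (x + y)) + norm2 (sqrt_half R * (x - y)) =
  norm2 x + norm2 y.
Proof.
case: x y => [a b] [c d]; rewrite /norm2 /sqrt_half /=; have := sqr_sqrt_half.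
move: (Num.sqrt _) => s ss.
transitivity (s ^+ 2 * 2 * (a ^+ 2 + b ^+ 2 + (c ^+ 2 + d ^+ 2))); first by ring.
by rewrite ss mulVf ?mul1r ?pnatr_eq0.
Qed.

Lemma weightE c : weight c = \sum_(b : (qnum c).-tuple bool) norm2 (amp c b).
Proof. by []. Qed.

Lemma weight_ge0 c : 0 <= weight c.
Proof. by apply: sumr_ge0 => b _; exact: norm2_ge0. Qed.

(** Strings whose new bit is 1 have amplitude 0; the remaining ones are exactly the
    [rcons b false]. *)
Lemma sum_new_amp q (psi : seq bool -> R[i]) :
  \sum_(b : q.+1.-tuple bool) norm2 (new_amp q psi b) =
  \sum_(b : q.-tuple bool) norm2 (psi b).
Proof.
rewrite (bigID (fun b : q.+1.-tuple bool => bit b q)) /= big1 ?add0r; last first.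
  by move=> b bq; rewrite /new_amp bq norm2_0.
pose h (b : q.-tuple bool) : q.+1.-tuple bool := [tuple of rcons b false].
(* The default of [insubd] is never reached, since [take q b] has size [q]. *)
pose h' (b : q.+1.-tuple bool) : q.-tuple bool :=
  insubd [tuple of nseq q false] (take q b).
have h'E b : h' b = take q b :> seq bool.
  by rewrite val_insubd size_take size_tuple ltnSn eqxx.
rewrite (reindex_onto h h') /=; last first.
  move=> b bq; apply/val_inj; rewrite /= h'E -{2}(take_size (val b)) size_tuple.
  by rewrite (take_nth false) ?size_tuple //; congr rcons;
    move: bq; rewrite /bit; case: (nth _ _ _).
have hK b : take q (h b) = b :> seq bool.
  by rewrite /= -cats1 take_cat size_tuple ltnn subnn take0 cats0.
have hq b : bit (h b) q = false.
  by rewrite /bit /= nth_rcons size_tuple ltnn eqxx.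
apply: eq_big => b; last by rewrite /new_amp hq hK.
by rewrite hq /=; apply/eqP/val_inj; rewrite /= h'E hK.
Qed.

Lemma norm2_had_flip q (psi : seq bool -> R[i]) b : (q < size b)%N ->
  norm2 (had_amp q psi b) + norm2 (had_amp q psi (flip q b)) =
  norm2 (psi b) + norm2 (psi (flip q b)).
Proof.
move=> qb; rewrite /had_amp !setbit_flip // /flip bit_setbit eqxx.
have := setbit_bit qb; case: (bit b q) => /= sb;
  rewrite expr0 expr1 mulN1r mul1r ?norm2_had ?sb //.
by rewrite addrC norm2_had addrC.
Qed.

Lemma norm2_cnot_flip p q (psi : seq bool -> R[i]) b :
    (q < size b)%N -> p != q ->
  norm2 (cnot_amp p q psi b) + norm2 (cnot_amp p q psi (flip q b)) =
  norm2 (psi b) + norm2 (psi (flip q b)).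
Proof.
move=> qb pq; rewrite /cnot_amp setbit_flip // {1 2}/flip !bit_setbit eqxx.
rewrite (negbTE pq); case: (bit b p); rewrite ?addbT ?addbF ?negbK.
  by rewrite setbit_bit // addrC.
by rewrite setbit_bit.
Qed.

(** Conservation of probability: gates preserve the norm, a coin halves the weight, and a
    measurement splits it between two complementary projections. *)
Lemma weight_step (i : instr) c :
  \sum_(wc <- step i c) wc.1 * weight wc.2 = weight c.
Proof.
case: c => p f m q psi.
case: i => [r x|r s|r s|r a|a r|r l|r||a|a|a b|a r];
  rewrite /step ?big_seq1 /= ?mul1r //.
- by rewrite !big_cons big_nil /= !weightE /=; lra.
- exact: sum_new_amp.
- case: ifP => // aq.
  apply: (eq_sum_flip (F := norm2 \o had_amp (f a) psi)
    (G := norm2 \o psi) aq) => b sb /=.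
  by apply: norm2_had_flip; rewrite sb.
- case: ifP => // aq; rewrite !weightE; apply: eq_bigr => b _ /=; rewrite /t_amp.
  by case: (bit _ _); rewrite ?norm2_omega8 ?mul1r.
- case: ifP => // /and3P[aq bq ab].
  apply: (eq_sum_flip (F := norm2 \o cnot_amp (f a) (f b) psi)
    (G := norm2 \o psi) bq) => x sx /=.
  by apply: norm2_cnot_flip; rewrite ?sx.
- case: ifP => aq; last by rewrite big_seq1 mul1r.
  rewrite !big_cons big_nil /= addr0 !mul1r !weightE -big_split.
  apply: eq_bigr => b _ /=; rewrite /proj_amp.
  by case: (bit _ _); rewrite /= norm2_0 ?addr0 ?add0r.
Qed.


(** * Halting probabilities and their limits *)

Lemma ler_sum_step (i : instr) c (f g : config R -> R) :
    (forall c', f c' <= g c') ->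
  \sum_(wc <- step i c) wc.1 * f wc.2 <= \sum_(wc <- step i c) wc.1 * g wc.2.
Proof.
have half0 : 0 <= 2^-1 :> R by rewrite invr_ge0.
move=> fg; case: c => p m e q psi.
case: i => [r x|r s|r s|r a|a r|r l|r||a|a|a b|a r];
  rewrite /step; try case: ifP => _;
  by rewrite ?big_seq1 ?big_cons ?big_nil /= ?addr0 ?mul1r ?lerD ?ler_wpM2l.
Qed.

Lemma halt_prob_ge0 A P t c : 0 <= halt_prob A P t c.
Proof.
elim: t c => [|t IH] c /=; case: onth => [i|] //;
  try by case: ifP => // _; exact: weight_ge0.
apply: le_trans (ler_sum_step i c IH).
by rewrite big1 // => wc _; rewrite mulr0.
Qed.

Lemma halt_prob_predC A P t c :
  halt_prob A P t c + halt_prob A (predC P) t c = halt_prob A predT t c.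
Proof.
elim: t c => [|t IH] c /=; case: onth => [i|]; rewrite ?addr0 //;
  try by case: (P _); rewrite /= ?addr0 ?add0r.
by rewrite -big_split /=; apply: eq_bigr => wc _; rewrite -mulrDr IH.
Qed.

Lemma halt_probS A P t c :
  halt_prob A P t.+1 c =
  if onth A (pc c) is Some i then
    \sum_(wc <- step i c) wc.1 * halt_prob A P t wc.2
  else if P (regs c 0%N) then weight c else 0.
Proof. by []. Qed.

Lemma halt_prob_det A P t i c c' :
    onth A (pc c) = Some i -> step i c = [:: (1, c')] ->
  halt_prob A P t.+1 c = halt_prob A P t c'.
Proof. by move=> Ai ic; rewrite halt_probS Ai ic big_seq1 mul1r. Qed.

(** Raising the step bound only adds the runs that had not halted before. *)
Lemma halt_prob_leS A P t c : halt_prob A P t c <= halt_prob A P t.+1 c.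
Proof.
elim: t c => [|t IH] c.
  have := halt_prob_ge0 A P 1 c; rewrite /=; case: onth => [i|] //.
rewrite [leLHS]halt_probS [leRHS]halt_probS; case: onth => [i|] //.
exact: ler_sum_step.
Qed.

Lemma halt_prob_le A P t t' c :
  (t <= t')%N -> halt_prob A P t c <= halt_prob A P t' c.
Proof.
move=> /subnK <-; elim: (t' - t)%N => // s IH.
exact: le_trans IH (halt_prob_leS _ _ _ _).
Qed.

Lemma halt_prob_le_weight A P t c : halt_prob A P t c <= weight c.
Proof.
elim: t c => [|t IH] c /=; case: onth => [i|]; rewrite ?weight_ge0 //;
  try by case: ifP => _; rewrite ?weight_ge0.
by rewrite -(weight_step i c) ler_sum_step.
Qed.

Lemma weight_init n (G : graph n) x : weight (init R G x) = 1.
Proof.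
rewrite weightE /= (eq_bigr (fun=> 1)) => [|b _].
  by rewrite sumr_const card_tuple expn0.
by rewrite /norm2 /= expr1n expr0n addr0.
Qed.

Section Halting.
Variables (A : program) (n : nat) (G : graph n) (x T : nat).
Hypothesis AT : halt_prob A predT T (init R G x) = 1.

Lemma halt_prob_predT t : (T <= t)%N -> halt_prob A predT t (init R G x) = 1.
Proof.
move=> Tt; apply/eqP; rewrite eq_le -{1}(weight_init G x) halt_prob_le_weight.
by rewrite -AT halt_prob_le.
Qed.

(** The probabilities of [P] and of its complement are both nondecreasing in time and already sum to
    1 at time [T], so neither can grow afterwards. *)
Lemma halt_prob_stable P t :
  (T <= t)%N -> halt_prob A P t (init R G x) = halt_prob A P T (init R G x).
Proof.
move=> Tt; apply/eqP; rewrite eq_le [X in _ && X]halt_prob_le // andbT.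
have := halt_prob_predC A P t (init R G x).
have := halt_prob_predC A P T (init R G x).
have := halt_prob_le A (predC P) (init R G x) Tt.
rewrite AT halt_prob_predT //; lra.
Qed.

Lemma output_probE P t : (T <= t)%N ->
  output_prob R A P G x = halt_prob A P t (init R G x).
Proof.
move=> Tt; rewrite halt_prob_stable //; apply: cvg_lim => //.
apply: cvg_near_cst; exists T => // s /= Ts; exact: halt_prob_stable.
Qed.

Lemma reject_probE : reject_prob R A G x = 1 - accept_prob R A G x.
Proof.
rewrite /reject_prob /accept_prob !(output_probE _ (leqnn T)) -AT.
rewrite -(halt_prob_predC A (fun o => o != 0%N)) addrAC subrr add0r.
by congr halt_prob; apply/funext => o /=; rewrite negbK.
Qed.

Lemma accept_prob_ge0 : 0 <= accept_prob R A G x.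
Proof. by rewrite /accept_prob (output_probE _ (leqnn T)) halt_prob_ge0. Qed.

Lemma accept_prob_le1 : accept_prob R A G x <= 1.
Proof.
rewrite /accept_prob (output_probE _ (leqnn T)) -(weight_init G x).
exact: halt_prob_le_weight.
Qed.

End Halting.

(** * Running a program after a preprocessing prefix *)

(** Jump targets are absolute, so they must move along with the code. *)
Definition shift_instr (s : nat) (i : instr) : instr :=
  if i is Jz r l then Jz r (s + l) else i.

Definition shift_pc (s : nat) c : config R :=
  Config (s + pc c) (regs c) (memory c) (qnum c) (amp c).

Definition prepend (pre A : program) : program :=
  pre ++ map (shift_instr (size pre)) A.

Lemma step_shift s (i : instr) c :
  step (shift_instr s i) (shift_pc s c) =
  [seq (wc.1, shift_pc s wc.2) | wc <- step i c].
Proof.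
case: c => p m e q psi.
case: i => [r x|r t|r t|r a|a r|r l|r||a|a|a b|a r];
  rewrite /step /shift_pc /= ?addnS //; by case: ifP => //=; rewrite addnS.
Qed.

(** The relocated code simulates [A] step by step, and line [size pre + l] exists exactly when line
    [l] of [A] does, so both halt together. *)
Lemma halt_prob_prepend pre A P t c :
  halt_prob (prepend pre A) P t (shift_pc (size pre) c) = halt_prob A P t c.
Proof.
have E l : onth (prepend pre A) (size pre + l) =
    omap (shift_instr (size pre)) (onth A l).
  by rewrite onth_cat ltnNge leq_addr /= addKn onth_map.
elim: t c => [|t IH] c; first by rewrite /= E; case: onth.
rewrite !halt_probS [pc _]/= E; case: onth => [i|] //.
transitivity (\sum_(wc <- step (shift_instr (size pre) i) (shift_pc (size pre) c))
    wc.1 * halt_prob (prepend pre A) P t wc.2) => //.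
by rewrite step_shift big_map; apply: eq_bigr => wc _; rewrite IH.
Qed.

(* Register 2 is a scratch register for computing d = k - 2; it must be reset
   since A may rely on its initial value 0. *)
Definition reduction (A : program) : program :=
  prepend [:: Const 2 2; Defs.Sub 1 2; Const 2 0] A.

Lemma halt_prob_reduction A P t n (G : graph n) k :
  halt_prob (reduction A) P (3 + t) (init R G k) =
  halt_prob A P t (init R G (k - 2)).
Proof.
rewrite -[RHS](halt_prob_prepend [:: Const 2 2; Defs.Sub 1 2; Const 2 0]).
(* The prefix runs in three deterministic steps. Afterwards registers 0, 1, 2 hold [n], [k - 2], 0
   and the rest is untouched, as in the initial configuration for [k - 2]. *)
do 3!(eapply etrans; [eapply halt_prob_det; reflexivity|]).
congr halt_prob; congr Config; apply/funext => -[|[|[|r]]] //.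
Qed.

Lemma poly_time_reduction A : poly_time R A -> poly_time R (reduction A).
Proof.
move=> [e eP]; exists (e + 4)%N => n G x xn.
have xn2 : (x - 2 <= n)%N by rewrite (leq_trans _ xn) ?leq_subr.
(* Of the additive 4, three pay for the prefix. The spare 1 covers [n = 0] with [e = 0], where
   [n ^ e = 1] but [n ^ (e + 4) = 0]. *)
have -> : (n ^ (e + 4) + (e + 4) = 3 + (n ^ (e + 4) + e + 1))%N by ring.
rewrite halt_prob_reduction; apply: (halt_prob_predT (eP _ _ _ xn2)).
case: n {G xn xn2} => [|n]; first
  by case: e {eP} => //= e; rewrite !exp0n ?addn4 ?leq_addr.
by rewrite -addnA leq_add ?leq_pexp2l ?leq_addr.
Qed.

Lemma accept_prob_reduction A n (G : graph n) k T :
    halt_prob A predT T (init R G (k - 2)) = 1 ->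
  accept_prob R (reduction A) G k = accept_prob R A G (k - 2).
Proof.
move=> AT; rewrite /accept_prob (output_probE AT _ (leqnn T)).
have BT : halt_prob (reduction A) predT (3 + T) (init R G k) = 1.
  by rewrite halt_prob_reduction.
by rewrite (output_probE BT _ (leqnn _)) halt_prob_reduction.
Qed.

End Machine.

(** * Homology of skeleta of clique complexes *)

Section Homology.
Context {R : realType} {n : nat}.
Implicit Types (K : {set {set 'I_n}}) (S : {set 'I_n}) (d : nat).

Lemma chain_eq0 K d (c : chain R K d) :
  (forall s : {set 'I_n}, s \in K -> #|s| <> d.+1) -> c = 0.
Proof.
move=> noface; apply/ffunP => -[s /= sP]; exfalso.
by move: (sP) => /andP[/noface + /eqP].
Qed.

(** A class is zero exactly when its representative is a boundary, which trades the quotient for an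
    inclusion of subspaces. *)
Lemma homology_vanishesP K d :
  homology_vanishes R K d <-> (cycles R K d <= boundaries R K d)%VS.
Proof.
have piE (z : subvs_of (cycles R K d)) :
    (\pi_(homology R K d)%qT z == 0) = (vsval z \in boundaries R K d).
  have := Quotient.idealrBE (GRing.ZmodClosed.clone _ (@is_boundary R n K d) _) z 0.
  rewrite subr0 => /esym zE; apply: etrans zE.
  have E0 : \pi_(homology R K d)%qT 0 = 0 by exact: pi_zeror.
  by rewrite -E0.
split=> [H0|sub h].
  apply/subvP => z zc.
  have /eqP := H0 (\pi_(homology R K d)%qT (vsproj (cycles R K d) z)).
  by rewrite piE vsprojK.
rewrite -[h]reprK; apply/eqP; rewrite piE.
by apply: (subvP sub); exact: subvsP.
Qed.

(** * The boundary of a simplex as a cycle *)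

Definition rank_in S (v : 'I_n) : nat := #|[set u in S | (u < v)%N]%SET|.

Lemma rank_inD1 S (v w : 'I_n) : v \in S ->
  rank_in (S :\ v)%SET w = (rank_in S w - (v < w))%N.
Proof.
move=> vS; rewrite /rank_in; have [vw|wv] := boolP (v < w)%N.
  rewrite (cardsD1 v [set u in S | (u < w)%N]%SET) inE vS vw addKn.
  by apply: eq_card => u; rewrite !inE andbA.
rewrite subn0; apply: eq_card => u; rewrite !inE.
have [->|_] := eqVneq u v; rewrite /= ?(negbTE wv) ?andbF //.
Qed.

(** Deleting the smaller vertex lowers the rank of the larger by one, while deleting the larger
    leaves the rank of the smaller unchanged. *)
Lemma rank_in_swap S (v w : 'I_n) : v \in S -> w \in S -> v != w ->
  (-1) ^+ rank_in (S :\ v)%SET w * (-1) ^+ rank_in S v =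
  - ((-1) ^+ rank_in (S :\ w)%SET v * (-1) ^+ rank_in S w) :> R.
Proof.
wlog: v w / (v < w)%N => [hw vS wS vw|vw vS wS _].
  have [lt|gt|/val_inj e] := ltngtP v w; first exact: hw.
    by rewrite (hw w v) // 1?eq_sym // opprK.
  by rewrite e eqxx in vw.
rewrite !rank_inD1 // vw ltnNge ltnW //= subn0.
have -> : rank_in S w = (rank_in S w).-1.+1.
  rewrite prednK // card_gt0; apply/set0Pn; exists v.
  by rewrite inE vS.
by rewrite subn1 /= exprS mulN1r mulrN opprK mulrC.
Qed.

(** Defined without going through [bd], because [S] is not a face of the skeleton; only its facets
    are. *)
Definition simplex_boundary K d S : chain R K d :=
  [ffun t : face K d =>
     \sum_(v in S | (S :\ v)%SET == val t) (-1) ^+ rank_in S v].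

Lemma simplex_boundary_cycle K d S :
  #|S| = d.+2 -> (forall v, v \in S -> (S :\ v)%SET \in K) ->
  simplex_boundary K d S \in cycles R K d.
Proof.
move=> cS SK; case: d cS => [|d] cS; first exact: memvf.
rewrite /cycles memv_ker lfunE; apply/eqP/ffunP => t; rewrite /= !ffunE.
have cSD v : v \in S -> #|(S :\ v)%SET| = d.+2.
  by move=> vS; move: cS; rewrite (cardsD1 v) vS => -[].
pose F v w : R := (-1) ^+ rank_in (S :\ v)%SET w * (-1) ^+ rank_in S v.
pose Q v w := [&& v \in S, w \in S, v != w & (S :\ v :\ w)%SET == val t].
(* The double boundary becomes a sum over ordered pairs: [v] is deleted first, then [w]. *)
transitivity (\sum_v \sum_(w | Q v w) F v w).
  pose g (v : 'I_n) (s : face K d.+1) := (v \in S) && ((S :\ v)%SET == val s).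
  transitivity (\sum_(s : face K d.+1) \sum_(v | g v s)
      \sum_(w in val s | (val s :\ w)%SET == val t) F v w).
    apply: eq_bigr => s _; rewrite exchange_big /=; apply: eq_bigr => w _.
    rewrite ffunE mulr_sumr; apply: eq_big => // v /andP[_ /eqP e].
    by rewrite /F e.
  rewrite (exchange_big_dep predT) //=; apply: eq_bigr => v _.
  have [vS|vS] := boolP (v \in S); last first.
    by rewrite big_pred0 ?big_pred0 // => w; rewrite /Q /g (negbTE vS).
  (* For fixed [v], the only face contributing to the sum over [s] is the facet [S :\ v]. *)
  have fP : ((S :\ v)%SET \in K) && (#|(S :\ v)%SET| == d.+2).
    by rewrite SK //= cSD.
  rewrite (big_pred1 (exist _ (S :\ v)%SET fP)) => [|s]; last first.
    by rewrite /g vS /= -val_eqE /= eq_sym.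
  apply: eq_bigl => w; rewrite /Q /= !inE vS /= eq_sym.
  by rewrite andbA [_ && (w \in S)]andbC.
(* Exchanging the order of deletion flips every sign, so the sum is its own negative and hence 0. *)
have anti : \sum_v \sum_(w | Q v w) F v w = - \sum_v \sum_(w | Q v w) F v w.
  rewrite {1}(exchange_big_dep predT) //= -sumrN; apply: eq_bigr => v _.
  rewrite -sumrN; apply: eq_big => [w|w /and4P[wS vS wv _]].
    rewrite /Q eq_sym; have -> : (S :\ w :\ v = S :\ v :\ w)%SET.
      by apply/setP => u; rewrite !inE andbCA.
    by case: (v \in S); case: (w \in S).
  by rewrite /F rank_in_swap.
by apply/eqP; move/eqP: anti; rewrite -addr_eq0 -mulr2n mulrn_eq0.
Qed.

(** Distinct vertices give distinct facets, so the coefficient at a facet is a single sign. *)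
Lemma simplex_boundary_neq0 K d S :
  #|S| = d.+2 -> (forall v, v \in S -> (S :\ v)%SET \in K) ->
  simplex_boundary K d S != 0.
Proof.
move=> cS SK; have /card_gt0P[v vS] : (0 < #|S|)%N by rewrite cS.
have fP : ((S :\ v)%SET \in K) && (#|(S :\ v)%SET| == d.+1).
  by rewrite SK //=; move: cS; rewrite (cardsD1 v) vS add1n => /eqP; rewrite eqSS.
pose t : face K d := exist _ (S :\ v)%SET fP.
apply/eqP => /ffunP/(_ t); rewrite !ffunE /= (big_pred1 v).
  by move/eqP; rewrite signr_eq0.
move=> w /=; have [->|wv] := eqVneq w v; first by rewrite vS eqxx.
apply/negbTE/negP => /andP[wS /eqP/setP/(_ v)].
by rewrite !inE eqxx vS /= eq_sym wv.
Qed.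

(** * Cliques and the homology of the skeleton *)

Definition is_clique (G : graph n) S :=
  [forall u in S, forall v in S, (u != v) ==> adj G u v].

Lemma is_cliqueS (G : graph n) S S' :
  S' \subset S -> is_clique G S -> is_clique G S'.
Proof.
move=> /fintype.subsetP sS /forall_inP cl.
apply/forall_inP => u uS; apply/forall_inP => v vS.
by have /forall_inP := cl u (sS _ uS); apply; exact: sS.
Qed.

Lemma skel_clique_vanishes (G : graph n) d :
  (forall S, #|S| = d.+1 -> ~~ is_clique G S) ->
  homology_vanishes R (skel d (clique_complex G)) d.
Proof.
move=> noclique; apply/homology_vanishesP/subvP => z _.
rewrite (@chain_eq0 _ _ z) ?mem0v // => s; rewrite !inE => /andP[/andP[_ cl] _] cs.
by have := noclique s cs; rewrite /is_clique cl.
Qed.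

Lemma skel_clique_not_vanishes (G : graph n) d S :
  #|S| = d.+2 -> is_clique G S ->
  ~ homology_vanishes R (skel d (clique_complex G)) d.
Proof.
move=> cS cl /homology_vanishesP/subvP.
set K := skel _ _.
have SK v : v \in S -> (S :\ v)%SET \in K.
  move=> vS; have cD : #|(S :\ v)%SET| = d.+1.
    by move: cS; rewrite (cardsD1 v) vS => -[].
  rewrite !inE cD leqnn /= andbT; apply: is_cliqueS cl; exact: subD1set.
move=> /(_ _ (simplex_boundary_cycle cS SK)) /memv_imgP[x _].
(* The preimage [x] is a chain of dimension [d.+1], and the skeleton has no faces that large. *)
rewrite (@chain_eq0 _ _ x) => [|s]; last first.
  by rewrite inE => /andP[_ +] e; rewrite e ltnn.
by rewrite linear0 => /eqP; apply/negP; exact: simplex_boundary_neq0.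
Qed.

Lemma clique_plant (G : graph n) S : is_clique (plant G S) S.
Proof.
apply/forall_inP => u uS; apply/forall_inP => v vS; apply/implyP => uv.
have e2 : #|[set u; v]%SET| == 2%N by rewrite cards2 uv.
apply/existsP; exists (exist _ [set u; v]%SET e2); rewrite /= eqxx andbT.
by rewrite !inE /= finset.subUset !finset.sub1set uS vS orbT.
Qed.

End Homology.

(** * Random graphs *)

Section Random.
Context {R : realType} {n : nat}.
Implicit Types (S : {set 'I_n}) (f : graph n -> R).

Lemma gnp_halfE (G : graph n) : gnp_half R G = 2^-1 ^+ #|{: edge n}|.
Proof.
rewrite /gnp_half (eq_bigr (fun=> 2^-1)) ?prodr_const //.
by move=> e _; case: ifP => // _; field.
Qed.

Definition edges_in S : {set edge n} := [set e : edge n | val e \subset S]%SET.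

Lemma card_edges_in S : #|edges_in S| = 'C(#|S|, 2).
Proof.
rewrite -(card_imset _ val_inj) -cards_draws; apply: eq_card => e.
rewrite !inE; apply/imsetP/andP => [[e' + ->]|[eS e2]].
  by rewrite inE => ->; split=> //; exact: (valP e').
by exists (exist _ e e2); rewrite ?inE.
Qed.

Lemma is_clique_edges (G : graph n) S : is_clique G S -> edges_in S \subset G.
Proof.
move=> /forall_inP cl; apply/fintype.subsetP => e; rewrite inE => eS.
have /cards2P[u [v [uv eE]]] := valP e.
move: eS; rewrite eE finset.subUset !finset.sub1set => /andP[uS vS].
have /forall_inP/(_ v vS) := cl u uS; rewrite uv /= => /existsP[e' /andP[e'G /eqP e'E]].
by rewrite (_ : e = e') //; apply/val_inj; rewrite eE e'E.
Qed.

(** Complementation maps the supersets of [A] bijectively onto the subsets of [~: A]. *)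
Lemma card_supersets (T : finType) (A : {set T}) :
  #|[set B : {set T} | A \subset B]%SET| = (2 ^ (#|T| - #|A|))%N.
Proof.
have -> : (#|T| - #|A| = #|~: A|)%N by rewrite [RHS]cardsCs finset.setCK.
rewrite -card_powerset.
rewrite -(card_imset _ (inv_inj (@finset.setCK T))).
apply: eq_card => B; rewrite powersetE.
apply/imsetP/idP => [[C + ->]|BA]; first by rewrite inE finset.setCS.
by exists (~: B)%SET; rewrite ?finset.setCK // inE -finset.setCS finset.setCK.
Qed.

(** The measure is uniform, so this is a count: all edges inside [S] are forced and only the others
    are free. *)
Lemma prob_clique S :
  \sum_(G : graph n | is_clique G S) gnp_half R G <= 2^-1 ^+ 'C(#|S|, 2).
Proof.
rewrite (eq_bigr (fun=> 2^-1 ^+ #|{: edge n}|)) => [|G _]; last exact: gnp_halfE.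
rewrite sumr_const.
have le : (#|[pred G : graph n | is_clique G S]| <=
    2 ^ (#|{: edge n}| - #|edges_in S|))%N.
  rewrite -card_supersets; apply: subset_leq_card; apply/fintype.subsetP => G.
  by rewrite !inE; exact: is_clique_edges.
apply: le_trans (ler_wpMn2l _ le) _; first by rewrite exprn_ge0 ?invr_ge0.
rewrite -card_edges_in -[leLHS]mulr_natr natrX.
have := max_card (mem (edges_in S)); set N := #|{: edge n}|; set M := #|_| => MN.
rewrite -(subnK MN) exprD addnK mulrAC -exprMn mulVf ?pnatr_eq0 //.
by rewrite expr1n mul1r.
Qed.

(** Union bound over the vertex sets of size [m]. *)
Lemma prob_exists_clique m :
  \sum_(G : graph n | [exists S : {set 'I_n}, (#|S| == m) && is_clique G S])
     gnp_half R G <= 'C(n, m)%:R * 2^-1 ^+ 'C(m, 2).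
Proof.
apply: (@le_trans _ _ (\sum_(S : {set 'I_n} | #|S| == m)
    \sum_(G : graph n | is_clique G S) gnp_half R G)).
  rewrite (exchange_big_dep predT) //= big_mkcond /=; apply: ler_sum => G _.
  have G0 : 0 <= gnp_half R G by rewrite gnp_halfE exprn_ge0 ?invr_ge0.
  case: ifP => [/existsP[S SP]|_]; last exact: sumr_ge0.
  by rewrite (bigD1 S) //= lerDl sumr_ge0.
rewrite -[in X in X%:R](card_ord n) -cardsT -cards_draws -sum1_card natr_sum.
rewrite mulr_suml; under [leRHS]eq_bigl do rewrite !inE finset.subsetT /=.
by apply: ler_sum => S /eqP <-; rewrite mul1r prob_clique.
Qed.

Lemma gnp_half_ge0 (G : graph n) : 0 <= gnp_half R G.
Proof. by rewrite gnp_halfE exprn_ge0 ?invr_ge0. Qed.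

Lemma sum_gnp_half : \sum_(G : graph n) gnp_half R G = 1.
Proof.
rewrite (eq_bigr (fun=> 2^-1 ^+ #|{: edge n}|)) => [|G _]; last exact: gnp_halfE.
rewrite sumr_const -(cardsT (graph n)) -(powersetT (edge n)) card_powerset cardsT.
by rewrite -[LHS]mulr_natr natrX -exprMn mulVf ?pnatr_eq0 ?expr1n.
Qed.

Lemma mean_gnp_planted k (f : graph n -> R) :
  mean (gnp_planted R k) f =
  \sum_(G0 : graph n) \sum_(S : {set 'I_n} | #|S| == k)
     gnp_half R G0 * ('C(n, k))%:R^-1 * f (plant G0 S).
Proof.
rewrite /mean /gnp_planted.
transitivity (\sum_(G : graph n) \sum_(G0 : graph n) \sum_(S : {set 'I_n} | #|S| == k)
  gnp_half R G0 * ('C(n, k))%:R^-1 * ((G == plant G0 S)%:R * f G)).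
  apply: eq_bigr => G _; rewrite mulr_suml; apply: eq_bigr => G0 _.
  by rewrite mulr_suml; apply: eq_bigr => S _; rewrite mulrA.
rewrite exchange_big /=; apply: eq_bigr => G0 _.
rewrite exchange_big /=; apply: eq_bigr => S _.
rewrite (bigD1 (plant G0 S)) //= eqxx mul1r big1 ?addr0 // => G /negbTE ->.
by rewrite mul0r mulr0.
Qed.

(** The bound [k <= n] makes the normalizing binomial nonzero. *)
Lemma sum_gnp_planted k : (k <= n)%N ->
  \sum_(G : graph n) gnp_planted R k G = 1.
Proof.
move=> kn; have := mean_gnp_planted k (fun=> 1).
rewrite /mean; under eq_bigr do rewrite mulr1; move=> ->.
rewrite -[RHS]sum_gnp_half; apply: eq_bigr => G0 _.
under eq_bigr do rewrite mulr1.
rewrite sumr_const.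
have -> : #|[pred S : {set 'I_n} | #|S| == k]| = 'C(n, k).
  rewrite -[in RHS](card_ord n) -card_draws; apply: eq_card => S.
  by rewrite !inE.
by rewrite -[LHS]mulr_natr mulfVK // pnatr_eq0 -lt0n bin_gt0.
Qed.

Lemma mean_mixture k f :
  mean (@planted_mixture R n k) f =
  2^-1 * mean (@gnp_half R n) f + 2^-1 * mean (gnp_planted R k) f.
Proof.
rewrite /mean !mulr_sumr -big_split; apply: eq_bigr => G _.
by rewrite mulrDl !mulrA.
Qed.

End Random.

(** * Asymptotic estimates in the clique range *)

Lemma leq_bin_exp n m : ('C(n, m) <= n ^ m)%N.
Proof.
apply: (@leq_trans (n ^_ m)).
  by rewrite -bin_ffact leq_pmulr ?fact_gt0.
by elim: m => // m IH; rewrite ffactnSr expnSr leq_mul ?leq_subr.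
Qed.

Section Asymptotics.
Context {R : realType}.
Variables (eps : R) (k : nat -> nat).
Hypothesis eps0 : 0 < eps.
Hypothesis kP : clique_range eps k.

Lemma ln_nat_ge (M : R) : \forall n \near \oo, M <= ln n%:R.
Proof.
near=> n; have le : expR M <= n%:R by near: n; exact: nbhs_infty_ger.
by rewrite -[M]expRK ler_ln ?posrE ?expR_gt0 // (lt_le_trans _ le) ?expR_gt0.
Unshelve. all: by end_near. Qed.

Lemma clique_range_le : \forall n \near \oo, (k n <= n)%N.
Proof.
near=> n.
have n1 : (1 <= n)%N by near: n; exists 1%N.
have /andP[_ le] : (2 + eps) * (ln n%:R / ln 2) <= (k n)%:R <= n%:R `^ (2^-1 - eps).
  by near: n.
rewrite -(ler_nat R) (le_trans le) // -[leRHS]powRr1 // ler_powR ?ler1n //.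
by have := eps0; lra.
Unshelve. all: by end_near. Qed.

Lemma clique_range_gt2 : \forall n \near \oo, (2 < k n)%N.
Proof.
near=> n.
have /andP[le _] : (2 + eps) * (ln n%:R / ln 2) <= (k n)%:R <= n%:R `^ (2^-1 - eps).
  by near: n.
have n4 : (4 <= n)%N by near: n; exists 4%N.
have l2 : 0 < ln 2 :> R by rewrite ln_gt0 // ltr1n.
rewrite -(ltr_nat R) (lt_le_trans _ le) //.
(* From [n >= 4], the binary logarithm is at least 2, so [k n] even exceeds 4. *)
have : 2 <= ln (n%:R : R) / ln 2.
  rewrite ler_pdivlMr // mulr_natl -lnXn // ler_ln ?posrE ?ltr0n //.
    by rewrite -natrX ler_nat.
  by rewrite exprn_gt0.
  exact: (leq_trans _ n4).
by have := eps0; nra.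
Unshelve. all: by end_near. Qed.

(** The lower bound on [k n] gives [2 ^ k >= n ^ (2 + eps)], and [n ^ eps] eventually exceeds any
    constant. *)
Lemma clique_range_pow (c : R) : \forall n \near \oo, c * n%:R ^+ 2 <= 2 ^+ k n.
Proof.
near=> n.
have n1 : (1 <= n)%N by near: n; exists 1%N.
have /andP[le _] : (2 + eps) * (ln n%:R / ln 2) <= (k n)%:R <= n%:R `^ (2^-1 - eps).
  by near: n.
have l2 : 0 < ln 2 :> R by rewrite ln_gt0 // ltr1n.
have [c0|c0] := leP c 0.
  by rewrite (@le_trans _ _ 0) ?exprn_ge0 // mulr_le0_ge0 // exprn_ge0.
(* This threshold is [n ^ eps >= c] in logarithmic form. *)
have lnn : ln c / eps <= ln (n%:R : R) by near: n; exact: ln_nat_ge.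
have n0 : 0 < n%:R :> R by rewrite ltr0n.
rewrite -ler_ln ?posrE ?mulr_gt0 ?exprn_gt0 // lnM ?posrE ?exprn_gt0 // !lnXn //.
rewrite -[ln n%:R *+ 2]mulr_natl -[_ *+ k n]mulr_natl.
have le' : (2 + eps) * ln n%:R <= (k n)%:R * ln 2 by rewrite -ler_pdivrMr // -mulrA.
have : ln c <= eps * ln n%:R by rewrite mulrC -ler_pdivrMr.
lra.
Unshelve. all: by end_near. Qed.

Lemma clique_count_small (eta : R) : 0 < eta -> \forall n \near \oo,
  'C(n, k n - 1)%:R * 2^-1 ^+ 'C(k n - 1, 2) <= eta.
Proof.
move=> eta0; near=> n.
have k2 : (2 < k n)%N by near: n; exact: clique_range_gt2.
(* With [k n = m + 2], the factor 4 absorbs [2 ^ 2]: the two bounds become [x <= eta ^ 2] and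
   [x <= 1]. *)
have kpow : (4 / eta ^+ 2) * n%:R ^+ 2 <= 2 ^+ k n by near: n; exact: clique_range_pow.
have kpow1 : 4 * n%:R ^+ 2 <= 2 ^+ k n :> R by near: n; exact: clique_range_pow.
case: (k n) k2 kpow kpow1 => // -[//|m] m0 kpow kpow1.
rewrite subSS subn0; set q := m.+1.
pose x : R := n%:R ^+ 2 * 2^-1 ^+ m.
have x0 : 0 <= x by rewrite mulr_ge0 ?exprn_ge0 ?invr_ge0.
have p0 : 0 < 2 ^+ m :> R by rewrite exprn_gt0.
have xle : x <= eta ^+ 2.
  rewrite /x exprVn ler_pdivrMr // -ler_pdivrMl ?exprn_gt0 //.
  move: kpow; rewrite !exprS; lra.
have x1 : x <= 1.
  rewrite /x exprVn ler_pdivrMr // mul1r.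
  move: kpow1; rewrite !exprS; lra.
have binq : ('C(q, 2) * 2 = m * q)%N.
  by rewrite bin2 /= muln2 even_halfK ?(mulnC m.+1) // oddM /= andbN.
have C0 : 0 <= 2^-1 ^+ 'C(q, 2) :> R by rewrite exprn_ge0 ?invr_ge0.
apply: (@le_trans _ _ (n%:R ^+ q * 2^-1 ^+ 'C(q, 2))).
  by rewrite ler_wpM2r // -natrX ler_nat leq_bin_exp.
(* The exponent m(m-1)/2 is doubled by squaring, which turns the bound into a
   power of x = n^2 / 2^(k-2). *)
rewrite -(@ler_pXn2r _ 2) ?nnegrE ?(ltW eta0) // ?mulr_ge0 ?exprn_ge0 ?invr_ge0 //.
have -> : (n%:R ^+ q * 2^-1 ^+ 'C(q, 2)) ^+ 2 = x ^+ q.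
  rewrite /x [LHS]exprMn [RHS]exprMn -!exprM; congr (_ * _); first by rewrite mulnC.
  by rewrite binq.
(* Since [x <= 1] and [q = m + 1], one factor of [x ^ q] suffices. *)
apply: le_trans xle; rewrite exprS ler_piMr // exprn_ile1 //.
Unshelve. all: by end_near. Qed.

End Asymptotics.

(** * From a homology decider to a distinguisher *)

Lemma homology_success_bound {R : realType} (A : program) n k (eta : R) :
    poly_time R A -> (2 <= k <= n)%N ->
    'C(n, k - 1)%:R * 2^-1 ^+ 'C(k - 1, 2) <= eta ->
  homology_success A (@planted_mixture R n k) (k - 2) <=
  2^-1 + 2^-1 * (advantage R (reduction A) n k + eta).
Proof.
move=> [e eP] /andP[k2 kn] countP.
have dn : (k - 2 <= n)%N by rewrite (leq_trans _ kn) ?leq_subr.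
have AT G := eP n G _ dn.
pose a (G : graph n) : R := accept_prob R A G (k - 2).
have a0 G : 0 <= a G by exact: accept_prob_ge0 (AT G).
have a1 G : a G <= 1 by exact: accept_prob_le1 (AT G).
rewrite /homology_success mean_mixture; set f := (f in mean _ f).
have null : mean (@gnp_half R n) f <= mean (@gnp_half R n) a + eta.
  apply: le_trans (lerD (lexx _) countP).
  apply: le_trans (lerD (lexx _) (prob_exists_clique _)).
  rewrite [X in _ <= _ + X]big_mkcond -big_split; apply: ler_sum => G _ /=.
  have g0 := @gnp_half_ge0 R n G.
  (* If a [(k - 1)]-clique exists, [f G <= a G + 1] and the extra 1 is charged to that event;
     otherwise homology vanishes and [f G = a G]. *)
  case: ifPn => [_|noclique].
    rewrite -[X in _ <= _ + X]mulr1 -mulrDr ler_wpM2l // /f.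
    case: asboolP => _; first by rewrite lerDl.
    by rewrite (reject_probE (AT G)) -/(a G); have := a0 G; lra.
  rewrite addr0 /f asboolT //; apply: skel_clique_vanishes => S cS.
  apply: contra noclique => cl; apply/existsP; exists S; rewrite cl cS andbT.
  by rewrite -subSn.
(* Homology never vanishes on planted graphs, so the correct answer there is always rejection. *)
have planted : mean (gnp_planted R k) f = 1 - mean (gnp_planted R k) a.
  have -> : mean (gnp_planted R k) f = mean (gnp_planted R k) (fun G => 1 - a G).
    rewrite !mean_gnp_planted; apply: eq_bigr => G _; apply: eq_bigr => S /eqP cS.
    rewrite /f asboolF ?(reject_probE (AT _)) //.
    apply: skel_clique_not_vanishes (clique_plant G S).
    by rewrite cS -[LHS](subnK k2) addn2.
  rewrite -[X in _ = X - _](sum_gnp_planted kn) -sumrB.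
  by apply: eq_bigr => G _; rewrite mulrBr mulr1.
have -> : advantage R (reduction A) n k =
    `|mean (@gnp_half R n) a - mean (gnp_planted R k) a|.
  rewrite /advantage.
  rewrite (_ : (fun G => _) = a) //.
  by apply/funext => G; rewrite (accept_prob_reduction (AT G)).
(* Acceptance points to the unplanted graph here; the absolute value in [advantage] makes the
   orientation harmless. *)
have := ler_norm (mean (@gnp_half R n) a - mean (gnp_planted R k) a).
move: null; rewrite planted; lra.
Qed.

Theorem corollary5 (R : realType) (eps : R) (heps : 0 < eps < 2^-1)
    (hqPC : qPC eps) (k : nat -> nat) (hk : clique_range eps k)
    (delta : R) (hdelta : 0 < delta) :
  ~ exists A : program,
      poly_time R A /\
      \forall n \near \oo,
        2^-1 + delta
          <= homology_success A (@planted_mixture R n (k n)) (k n - 2)%N.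
Proof.
have /andP[eps0 _] := heps.
move=> [A [Apoly Asucc]]; apply: (hqPC k hk delta hdelta).
exists (reduction A); split; first exact: poly_time_reduction.
near=> n.
have k2 : (2 < k n)%N by near: n; exact: clique_range_gt2 eps0 hk.
have kn : (k n <= n)%N by near: n; exact: clique_range_le eps0 hk.
(* Taking [eta = delta] turns [1/2 + delta <= 1/2 + (advantage + delta) / 2] into
   [delta <= advantage]. *)
have count : 'C(n, k n - 1)%:R * 2^-1 ^+ 'C(k n - 1, 2) <= delta.
  by near: n; exact: clique_count_small eps0 hk _ hdelta.
have succ : 2^-1 + delta <=
    homology_success A (@planted_mixture R n (k n)) (k n - 2)%N by near: n.
have kn2 : (2 <= k n <= n)%N by rewrite ltnW.
have := homology_success_bound Apoly kn2 count.
lra.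
Unshelve. all: by end_near. Qed.
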